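(* Let $\Delta=\bigsqcup_{i\in\mathbb Z}\Delta(i)$ be a $\mathbb Z$-grading of an irreducible reduced crystallographic root system spanning the Euclidean space $(V,(\,,\,))$, with compatible positive system, simple roots $\Pi=\bigsqcup_{i\ge0}\Pi(i)$ and Weyl group $W$. Let $\mathcal C^o=\{v\in V\mid (v,\alpha)>0\ \forall\alpha\in\Pi\}$ and $\mathcal C(0)^o=\{v\in V\mid (v,\alpha)>0\ \forall\alpha\in\Pi(0)\}$. For a lower ideal $I$ of $\Delta(1)$ put $$\mathcal R_I^o=\{x\in\mathcal C(0)^o\mid (x,\gamma)<0 \text{ for }\gamma\in I,\ (x,\gamma)>0\text{ for }\gamma\in\Delta(1)\setminus I\}.$$ Then: (i) each $\mathcal R^o_I$ is nonempty, and $I\mapsto\mathcal R^o_I$ is a bijection from the set of lower ideals of $\Delta(1)$ onto the set of regions (connected components) into which the hyperplanes $\mathcal H_\gamma$, $\gamma\in\Delta(1)$, dissect $\mathcal C(0)^o$; in particular the closures of the $\mathcal R^o_I$ cover the closure of $\mathcal C(0)^o$; (ii) if $w\in W^0_{\min}$, then $w^{-1}(\mathcal C^o)$ is the unique small chamber contained in $\mathcal R^o_{I_w}$ that is closest to $\mathcal C^o$; (iii) if $w\in W^0_{\max}$, then $w^{-1}(\mathcal C^o)$ is the unique small chamber contained in $\mathcal R^o_{I_w}$ that is farthest from $\mathcal C^o$.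
   Context: A $\mathbb Z$-grading: $\Delta=\bigsqcup_i\Delta(i)$ with $\gamma_1+\gamma_2\in\Delta(i_1+i_2)$ whenever $\gamma_j\in\Delta(i_j)$ and $\gamma_1+\gamma_2\in\Delta$; compatibility: $\Delta^+=\Delta(0)^+\sqcup\bigsqcup_{i\ge1}\Delta(i)$ with $\Delta(0)^+$ a positive system of $\Delta(0)$, $\Pi(i)=\Pi\cap\Delta(i)$; $\Delta(\ge1)=\bigsqcup_{j\ge1}\Delta(j)$. $\mathcal H_\gamma$ is the hyperplane orthogonal to $\gamma$. Small chambers are the sets $w(\mathcal C^o)$, $w\in W$; the distance between two small chambers is the number of hyperplanes $\mathcal H_\gamma$, $\gamma\in\Delta^+$, separating them. Order: $\mu\preccurlyeq\gamma$ iff $\gamma-\mu$ is a nonnegative integer combination of simple roots; lower ideals of $\Delta(1)$ are its downward closed subsets; $I^c=\Delta(1)\setminus I$. $N(w)=\{\gamma\in\Delta^+\mid w(\gamma)\in-\Delta^+\}$, $I_w=N(w)\cap\Delta(1)$. $W^0=\{w\in W\mid w(\alpha)\in\Delta^+\ \forall\alpha\in\Delta(0)^+\}$. For $J\subset\Delta^+$: $J^1=J$, $J^k=(J+J^{k-1})\cap\Delta$, $\langle J\rangle=\bigcup_{k\ge1}J^k$. $w_{I,\min}$ is the unique $w\in W$ with $N(w)=\langle I\rangle$, $w_{I,\max}$ the unique $w\in W$ with $N(w)=\Delta(\ge1)\setminus\langle I^c\rangle$; $W^0_{\min}=\{w_{I,\min}\}$ and $W^0_{\max}=\{w_{I,\max}\}$,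 $I$ ranging over lower ideals of $\Delta(1)$. *)

(* Defs.v *)
From HB Require Import structures.
From mathcomp Require Import all_boot all_order all_algebra finmap.
From mathcomp Require Import all_classical all_reals all_analysis.
Import Order.TTheory GRing.Theory Num.Theory.
Import numFieldNormedType.Exports.

Set Implicit Arguments.
Unset Strict Implicit.
Unset Printing Implicit Defensive.

Local Open Scope classical_set_scope.
Local Open Scope ring_scope.

(* A Euclidean space of dimension n is taken to be 'rV[R]_n with its usual
   topology and an arbitrary inner product f; the standard inner product is
   not assumed. *)
Section RootSystems.
Context {R : realType} {n : nat}.
Local Notation V := 'rV[R]_n.
Implicit Types (f : {dot V for idfun}) (D Dp P J I : set V) (w : V -> V).

Definition reflection f (a v : V) : V := v - (2 * f v a / f a a) *: a.

Record root_system f D : Prop := {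
  rs_finite : finite_set D;
  rs_span : <<fset_set D>>%VS = fullv;
  rs_neq0 : ~ D 0;
  rs_reflection : forall a b, D a -> D b -> D (reflection f a b);
  rs_crystallographic :
    forall a b, D a -> D b -> 2 * f b a / f a a \is a Num.int;
  rs_reduced : forall a (c : R), D a -> D (c *: a) -> c = 1 \/ c = - 1
}.

Definition irreducible f D : Prop :=
  D !=set0 /\
  forall A B, A !=set0 -> B !=set0 -> D = A `|` B ->
    ~ (forall a b, A a -> B b -> f a b = 0).

(* The reflections are involutions, so the monoid that they generate is the
   Weyl group. *)
Inductive weyl f D : set (V -> V) :=
| weyl_id : weyl f D id
| weyl_reflection a w :
    D a -> weyl f D w -> weyl f D (reflection f a \o w).

Definition positive_system f D P : Prop :=
  exists v : V,
    (forall a, D a -> f v a != 0) /\ P = [set a | D a /\ 0 < f v a].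

Definition simple_roots P : set V :=
  [set a | P a /\ ~ exists b c, [/\ P b, P c & a = b + c]].

Definition zgrading D (G : int -> set V) : Prop :=
  [/\ D = \bigcup_i G i,
      trivIset setT G &
      forall i j a b, G i a -> G j b -> D (a + b) -> G (i + j) (a + b)].

Definition degree_ge1 (G : int -> set V) : set V :=
  \bigcup_(i in [set i : int | 1 <= i]) G i.

Definition compatible f D (G : int -> set V) Dp : Prop :=
  [/\ positive_system f D Dp,
      positive_system f (G 0) (Dp `&` G 0),
      Dp = (Dp `&` G 0) `|` degree_ge1 G &
      (Dp `&` G 0) `&` degree_ge1 G = set0].

Definition hyperplane f (a : V) : set V := [set x | f x a = 0].

Definition open_chamber f (S : set V) : set V :=
  [set v | forall a, S a -> 0 < f v a].

Definition small_chambers f D Dp : set (set V) :=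
  [set w @` open_chamber f (simple_roots Dp) | w in weyl f D].

Definition separates f (a : V) (A B : set V) : Prop :=
  (forall x y, A x -> B y -> f x a < 0 < f y a) \/
  (forall x y, A x -> B y -> f y a < 0 < f x a).

Definition chamber_dist f Dp (A B : set V) : nat :=
  #|` fset_set
        [set hyperplane f a | a in [set a | Dp a /\ separates f a A B]]|.

(* The order in which c - b is a nonnegative integer combination of the
   simple roots. *)
Definition root_le Dp (b c : V) : Prop :=
  exists m : V -> nat, c - b = \sum_(a <- fset_set (simple_roots Dp)) a *+ m a.

Definition lower_ideals (G : int -> set V) Dp : set (set V) :=
  [set I | I `<=` G 1 /\
           forall b c, I c -> G 1 b -> root_le Dp b c -> I b].

Definition inversions Dp w : set V := [set a | Dp a /\ Dp (- w a)].

Definition inversions1 (G : int -> set V) Dp w : set V :=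
  inversions Dp w `&` G 1.

(* The exponent is shifted: iter_sums D J k is J^(k+1). *)
Fixpoint iter_sums D J (k : nat) : set V :=
  if k is k'.+1 then [set a + b | a in J & b in iter_sums D J k'] `&` D
  else J.

Definition generated D J : set V := \bigcup_k iter_sums D J k.

Definition W0_min f D (G : int -> set V) Dp : set (V -> V) :=
  [set w | weyl f D w /\
           exists2 I, lower_ideals G Dp I & inversions Dp w = generated D I].

Definition W0_max f D (G : int -> set V) Dp : set (V -> V) :=
  [set w | weyl f D w /\
           exists2 I, lower_ideals G Dp I &
             inversions Dp w = degree_ge1 G `\` generated D (G 1 `\` I)].

Definition chamber0 f (G : int -> set V) Dp : set V :=
  open_chamber f (simple_roots Dp `&` G 0).

Definition region f (G : int -> set V) Dp I : set V :=
  chamber0 f G Dp `&`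
  [set x | (forall a, I a -> f x a < 0) /\
           (forall a, (G 1 `\` I) a -> 0 < f x a)].

Definition dissected_chamber0 f (G : int -> set V) Dp : set V :=
  chamber0 f G Dp `\` \bigcup_(a in G 1) hyperplane f a.

Definition dissection f (G : int -> set V) Dp : set (set V) :=
  [set connected_component (dissected_chamber0 f G Dp) x
  | x in dissected_chamber0 f G Dp].

Definition closest_chambers f D Dp (S : set V) : set (set V) :=
  let C := open_chamber f (simple_roots Dp) in
  let inside := [set A | small_chambers f D Dp A /\ A `<=` S] in
  [set A | inside A /\
     forall B, inside B -> (chamber_dist f Dp A C <= chamber_dist f Dp B C)%N].

Definition farthest_chambers f D Dp (S : set V) : set (set V) :=
  let C := open_chamber f (simple_roots Dp) in
  let inside := [set A | small_chambers f D Dp A /\ A `<=` S] in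
  [set A | inside A /\
     forall B, inside B -> (chamber_dist f Dp B C <= chamber_dist f Dp A C)%N].

End RootSystems.

(* Main.v *)
(* A chamber [w^-1 C] is determined by the set N(w) of the positive roots that
   are negative on it, and its distance to C is the cardinality of N(w). On a
   region all roots of I, hence all of <I>, are negative, while all roots of
   <I^c> are positive; so N(w) lies between <I> and Delta(>=1) \ <I^c> for every
   chamber in the region, and the bounds characterize the two extreme chambers.
   A region is nonempty because <I> and its complement in Delta^+ are closed
   under addition, which makes <I> an inversion set. Everything about sums of
   roots rests on [root_exchange]. *)

Require Import Defs.
From HB Require Import structures.
From mathcomp Require Import all_boot all_order all_algebra finmap.
From mathcomp Require Import all_classical all_reals all_analysis.
From mathcomp Require Import ring lra zify.
Import Order.TTheory GRing.Theory Num.Theory.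
Import numFieldNormedType.Exports.

Local Open Scope classical_set_scope.
Local Open Scope ring_scope.

(** * Inner products and reflections *)

Section DotProduct.
Context {R : realType} {n : nat} (f : {dot 'rV[R]_n for idfun}).
Implicit Types a x y z : 'rV[R]_n.

Lemma dotC x y : f x y = f y x.
Proof. by rewrite hermC expr0 mul1r. Qed.

(* Stated for [f] alone: [linearDl] and its companions also match the bilinear
   products of scalars occurring in the formula of a reflection. *)
Lemma dotDl x y z : f (x + y) z = f x z + f y z.
Proof. exact: linearDl. Qed.

Lemma dotDr x y z : f z (x + y) = f z x + f z y.
Proof. exact: linearDr. Qed.

Lemma dotNl x y : f (- x) y = - f x y.
Proof. exact: linearNl. Qed.

Lemma dotNr x y : f x (- y) = - f x y.
Proof. exact: linearNr. Qed.

Lemma dotBl x y z : f (x - y) z = f x z - f y z.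
Proof. exact: linearBl. Qed.

Lemma dotBr x y z : f z (x - y) = f z x - f z y.
Proof. exact: linearBr. Qed.

Lemma dotZl t x y : f (t *: x) y = t * f x y.
Proof. exact: linearZl_LR. Qed.

Lemma dotZr t x y : f x (t *: y) = t * f x y.
Proof. exact: linearZr_LR. Qed.

Lemma dot_suml (I : Type) (r : seq I) (P : pred I) (F : I -> 'rV[R]_n) x :
  f (\sum_(i <- r | P i) F i) x = \sum_(i <- r | P i) f (F i) x.
Proof. exact: linear_sumlz. Qed.

Lemma dot_sumr (I : Type) (r : seq I) (P : pred I) (F : I -> 'rV[R]_n) x :
  f x (\sum_(i <- r | P i) F i) = \sum_(i <- r | P i) f x (F i).
Proof. exact: linear_sumr. Qed.

Lemma dot_gt0 {x} : x != 0 -> 0 < f x x.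
Proof. exact: neq0_dnorm_gt0. Qed.

Lemma dot_le0_eq0 {x} : f x x <= 0 -> x = 0.
Proof. by move=> x0; apply/eqP; apply: contraTT x0 => /dot_gt0; rewrite ltNge. Qed.

Lemma reflectionD a x y :
  reflection f a (x + y) = reflection f a x + reflection f a y.
Proof.
by rewrite /reflection dotDl mulrDr mulrDl scalerDl opprD addrACA.
Qed.

Lemma reflectionN a x : reflection f a (- x) = - reflection f a x.
Proof.
by rewrite /reflection dotNl mulrN mulNr scaleNr opprD.
Qed.

Lemma reflection_self {a} : a != 0 -> reflection f a a = - a.
Proof.
move=> /dot_gt0 a0; rewrite /reflection mulfK ?gt_eqF//.
by rewrite scaler_nat mulr2n opprD addNKr.
Qed.

Lemma dot_reflection {a} x y : a != 0 ->
  f (reflection f a x) (reflection f a y) = f x y.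
Proof.
move=> /dot_gt0 a0; rewrite /reflection !(dotBl, dotBr) /=.
rewrite !(dotZr, dotZl) /= (dotC a y).
by field; rewrite gt_eqF.
Qed.

Lemma reflectionK {a} : a != 0 -> involutive (reflection f a).
Proof.
move=> /dot_gt0 a0 x; rewrite /reflection dotBl dotZl /= -addrA.
rewrite -opprD -scalerDl.
suff -> : 2 * f x a / f a a + 2 * (f x a - 2 * f x a / f a a * f a a) / f a a = 0.
  by rewrite scale0r subr0.
by field; rewrite gt_eqF.
Qed.

End DotProduct.

(** * Sums and differences of roots; the Weyl group *)

Section RootSystem.
Context {R : realType} {n : nat} {f : {dot 'rV[R]_n for idfun}}.
Context {D : set 'rV[R]_n} (rsD : root_system f D).
Implicit Types a b c x y : 'rV[R]_n.

Lemma root_neq0 {a} : D a -> a != 0.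
Proof. by move=> Da; apply/eqP => a0; apply: (rs_neq0 rsD); rewrite -a0. Qed.

Lemma root_opp {a} : D a -> D (- a).
Proof.
by move=> Da; rewrite -(reflection_self f (root_neq0 Da)); exact: (rs_reflection rsD).
Qed.

(** If neither Cartan integer of [a] and [b] is 1, then both are at least 2, which forces
    [f (a - b) (a - b) <= 0]. If one of them is 1, a reflection sends one of the roots to [a - b] or
    [b - a]. *)
Lemma root_sub {a b} : D a -> D b -> a != b -> 0 < f a b -> D (a - b).
Proof.
move=> Da Db ab fab.
have aa := dot_gt0 f (root_neq0 Da); have bb := dot_gt0 f (root_neq0 Db).
have cartan x y : D x -> D y -> 0 < f x x -> 0 < f y x ->
    D (y - x) \/ f x x <= f y x.
  move=> Dx Dy xx fyx; have /intrP[m mE] := rs_crystallographic rsD Dx Dy.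
  have m0 : 0 < m by rewrite -(ltr0z R) -mE divr_gt0 ?mulr_gt0.
  have [m1|m1] := eqVneq m 1.
    by left; have := rs_reflection rsD Dx Dy; rewrite /reflection mE m1 scale1r.
  have : 2 <= m%:~R :> R by rewrite (ler_int R 2); lia.
  by rewrite -mE ler_pdivlMr//; right; lra.
case: (cartan _ _ Db Da bb fab) => // bab.
have fba : 0 < f b a by rewrite dotC.
case: (cartan _ _ Da Db aa fba) => [/root_opp|aab]; first by rewrite opprB.
 case/eqP: ab; apply/eqP; rewrite -subr_eq0; apply/eqP.
apply: (dot_le0_eq0 f); rewrite !(dotBl, dotBr) /= (dotC f b a) in aab *.
lra.
Qed.

Lemma root_add {a b} : D a -> D b -> a + b != 0 -> f a b < 0 -> D (a + b).
Proof.
move=> Da Db ab fab; rewrite -[b]opprK; apply: root_sub => //.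
- exact: root_opp.
- by rewrite -subr_eq0 opprK.
- by rewrite dotNr oppr_gt0.
Qed.

(* Otherwise [c] and [- (a + b + c)] would both make an acute or right angle
   with [a] and with [b], so [f (a + b) (a + b) <= 0]. *)
Lemma root_exchange {a b c} :
  D a -> D b -> D c -> D (a + b) -> D (a + b + c) ->
  [\/ D (a + c), D (b + c), a + c = 0 | b + c = 0].
Proof.
move=> Da Db Dc Dab Dabc.
have [ac0|ac0] := eqVneq (a + c) 0; first by constructor 3.
have [bc0|bc0] := eqVneq (b + c) 0; first by constructor 4.
have [?|Nac] := pselect (D (a + c)); first by constructor 1.
have [?|Nbc] := pselect (D (b + c)); first by constructor 2.
have fac : 0 <= f a c by rewrite leNgt; apply/negP => /root_add; auto.
have fbc : 0 <= f b c by rewrite leNgt; apply/negP => /root_add; auto.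
have abcB : a + b + c - b = a + c by rewrite addrAC addrK.
have abcA : a + b + c - a = b + c by rewrite addrAC [a + b]addrC addrK.
have fb : f (a + b + c) b <= 0.
  rewrite leNgt; apply/negP => /root_sub; rewrite -subr_eq0 abcB.
  by move=> /(_ Dabc Db ac0).
have fa : f (a + b + c) a <= 0.
  rewrite leNgt; apply/negP => /root_sub; rewrite -subr_eq0 abcA.
  by move=> /(_ Dabc Da bc0).
have := dot_gt0 f (root_neq0 Dab).
move: fa fb; rewrite !(dotDl, dotDr) /= (dotC f b a) (dotC f c a) (dotC f c b).
lra.
Qed.

(** [weyl] puts new reflections on the left; inverses and the construction of an element from its
    inversion set put them on the right. *)
Lemma weyl_compr {a w} : D a -> weyl f D w -> weyl f D (w \o reflection f a).
Proof.
move=> Da; elim=> [|b w' Db _ IH]; last exact: (weyl_reflection Db IH).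
exact: (weyl_reflection Da (weyl_id f D)).
Qed.

Lemma weyl_inv {w} : weyl f D w ->
  exists w', [/\ weyl f D w', cancel w w' & cancel w' w].
Proof.
elim=> [|a w1 Da _ [w' [w'W w1K w'K]]]; first by exists id; split=> //; exact: weyl_id.
have aK := reflectionK f (root_neq0 Da).
exists (w' \o reflection f a); split; first exact: weyl_compr.
- by move=> x /=; rewrite aK.
- by move=> x /=; rewrite w'K aK.
Qed.

Lemma weyl_root {w a} : weyl f D w -> D a -> D (w a).
Proof. by move=> + Da; elim=> // b w1 Db _; exact: (rs_reflection rsD). Qed.

Lemma weyl_dot {w} : weyl f D w -> forall x y, f (w x) (w y) = f x y.
Proof.
by elim=> // a w1 Da _ IH x y; rewrite /= dot_reflection//; exact: root_neq0.
Qed.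

Lemma weylN {w} : weyl f D w -> forall x, w (- x) = - w x.
Proof. by elim=> // a w1 Da _ IH x; rewrite /= IH reflectionN. Qed.

End RootSystem.

(** * Positive and simple roots; Weyl elements with prescribed inversions *)

Section PositiveSystem.
Context {R : realType} {n : nat} {f : {dot 'rV[R]_n for idfun}}.
Context {D Dp : set 'rV[R]_n}.
Context (rsD : root_system f D) (posDp : positive_system f D Dp).
Implicit Types a b c x y : 'rV[R]_n.
Local Notation S := (simple_roots Dp).

Lemma pos_root {a} : Dp a -> D a.
Proof. by case: posDp => v [_ ->] []. Qed.

Lemma posVneg {a} : D a -> Dp a \/ Dp (- a).
Proof.
move=> Da; case: posDp => v [/(_ a Da) + ->]; rewrite /mkset dotNr oppr_gt0.
by rewrite neq_lt => /orP[]; [right; split=> //; exact: (root_opp rsD)|left].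
Qed.

Lemma pos_opp {a} : Dp a -> ~ Dp (- a).
Proof.
case: posDp => v [_ ->] [_ va] [_]; rewrite dotNr oppr_gt0 => /(lt_trans va).
by rewrite ltxx.
Qed.

Lemma pos_add {a b} : Dp a -> Dp b -> D (a + b) -> Dp (a + b).
Proof.
case: posDp => v [_ ->] [_ va] [_ vb] Dab; split=> //.
by rewrite dotDr addr_gt0.
Qed.

Lemma pos_add_neq0 {a b} : Dp a -> Dp b -> a + b != 0.
Proof.
move=> Da Db; apply/eqP => /eqP; rewrite addr_eq0 => /eqP ab.
by apply: (pos_opp Db); rewrite -ab.
Qed.

Lemma pos_vector : exists v, forall a, Dp a -> 0 < f v a.
Proof. by case: posDp => v [_ ->]; exists v => a []. Qed.

Lemma pos_finite : finite_set Dp.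
Proof. by apply: sub_finite_set (rs_finite rsD) => a /pos_root. Qed.

Lemma simple_pos {a} : S a -> Dp a.
Proof. by case. Qed.

Lemma simple_finite : finite_set S.
Proof. by apply: sub_finite_set pos_finite => a []. Qed.

(** A positive root that is not simple is a sum of two positive roots with smaller values of [f v].
    As these values are real, the induction counts the positive roots of smaller value. *)
Lemma pos_ind (P : 'rV[R]_n -> Prop) :
  (forall a, S a -> P a) ->
  (forall a b, Dp a -> Dp b -> Dp (a + b) -> P a -> P b -> P (a + b)) ->
  forall a, Dp a -> P a.
Proof.
move=> PS PD; case: pos_vector => v v0 a.
pose below c := fset_set [set b | Dp b /\ f v b < f v c].
have belowf c : finite_set [set b | Dp b /\ f v b < f v c].
  by apply: sub_finite_set pos_finite => b [].
have ltb b c : Dp b -> f v b < f v c -> (#|` below b| < #|` below c|)%N.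
  move=> Db bc; apply: fproper_ltn_card; apply/andP; split.
    by apply/fsubsetP => x; rewrite !in_fset_set// !inE => -[Dx xb]; split=> //;
    exact: lt_trans xb bc.
  apply/negP => /fsubsetP/(_ b); rewrite !in_fset_set// !inE.
  by case=> //; rewrite ltxx.
have [k ak] := ubnP #|` below a|; elim: k a ak => // k IH a ak Da.
have [|NS] := pselect (exists b c, [/\ Dp b, Dp c & a = b + c]); last exact: PS.
move=> [b [c [Db Dc abc]]]; rewrite abc; apply: PD => //; first by rewrite -abc.
- apply: IH => //; apply: (leq_trans (ltb _ _ Db _) ak).
  by rewrite abc dotDr ltrDl v0.
- apply: IH => //; apply: (leq_trans (ltb _ _ Dc _) ak).
  by rewrite abc dotDr ltrDr v0.
Qed.

Lemma simple_obtuse {a b} : S a -> S b -> a != b -> f a b <= 0.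
Proof.
move=> Sa Sb ab; rewrite leNgt; apply/negP => fab.
have [Da Db] := (simple_pos Sa, simple_pos Sb).
have [Dab|] := posVneg (root_sub rsD (pos_root Da) (pos_root Db) ab fab).
  by case: Sa => _; apply; exists (a - b), b; split=> //; rewrite subrK.
rewrite opprB => Dba; case: Sb => _; apply; exists (b - a), a.
by split=> //; rewrite subrK.
Qed.

Lemma simple_sum1 {a} : S a ->
  \sum_(b <- fset_set S) b *+ (b == a) = a.
Proof.
move=> Sa; have aS : a \in fset_set S.
  by rewrite in_fset_set ?inE//; exact: simple_finite.
rewrite (bigD1_seq a) ?fset_uniq//= eqxx big1 ?addr0// => b /negPf -> //.
Qed.

Lemma pos_simple_sum {a} : Dp a ->
  exists m : 'rV[R]_n -> nat, a = \sum_(b <- fset_set S) b *+ m b.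
Proof.
move: a; apply: pos_ind => [a Sa|a b _ _ _ [m ->] [p ->]].
  by exists (fun b => b == a); rewrite simple_sum1.
exists (fun c => m c + p c)%N; rewrite -big_split/=.
by apply: eq_bigr => c _; rewrite mulrnDr.
Qed.

Lemma root_le_addr a b : Dp b -> root_le Dp a (a + b).
Proof. by move=> /pos_simple_sum[m mE]; exists m; rewrite addrC addKr. Qed.

(* If [u] and [w] collect the terms with nonnegative and negative coefficient,
   then [w = - u], while [simple_obtuse] gives [0 <= f u w]; so [u = 0]. *)
Lemma simple_free (k : 'rV[R]_n -> R) :
  \sum_(a <- fset_set S) k a *: a = 0 -> forall a, S a -> k a = 0.
Proof.
move=> k0; case: pos_vector => v v0.
have mS a : (a \in fset_set S) -> S a.
  by rewrite in_fset_set ?inE//; exact: simple_finite.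
pose u := \sum_(a <- fset_set S | 0 <= k a) k a *: a.
pose w := \sum_(a <- fset_set S | ~~ (0 <= k a)) k a *: a.
have uw : u + w = 0 by rewrite -k0 (bigID (fun a => 0 <= k a)).
have fuw : 0 <= f u w.
  rewrite dot_suml big_seq_cond; apply: sumr_ge0 => a /andP[/mS Sa ka].
  rewrite dot_sumr big_seq_cond; apply: sumr_ge0 => b /andP[/mS Sb kb].
  rewrite dotZl dotZr mulr_ge0// nmulr_rge0 ?ltNge// simple_obtuse//.
  by apply: contraNneq kb => <-.
have u0 : u = 0.
  apply: (dot_le0_eq0 f); move: fuw; have -> : w = - u by rewrite -(addKr u w) uw addr0.
  by rewrite dotNr oppr_ge0.
have w0 : w = 0 by rewrite -uw u0 add0r.
(* Pairing [u] and [w] with [v] turns their vanishing into that of a sum of nonnegative terms, so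
   each term is zero. *)
have : \sum_(a <- fset_set S) `|k a| * f v a = 0.
  transitivity (f v u - f v w); last by rewrite u0 w0 subrr.
  rewrite (bigID (fun a => 0 <= k a))/= /u /w !dot_sumr -sumrN.
  congr (_ + _); apply: eq_bigr => a ka; rewrite dotZr.
    by rewrite ger0_norm.
  by rewrite ltr0_norm ?ltNge// mulNr.
rewrite big_seq_cond => /eqP; rewrite psumr_eq0; last first.
  by move=> a; rewrite andbT => /mS[Da _]; rewrite mulr_ge0// ltW// v0.
move=> /allP ks a Sa.
have aS : a \in fset_set S by rewrite in_fset_set ?inE//; exact: simple_finite.
have := ks _ aS; rewrite aS /= mulf_eq0 normr_eq0 => /orP[/eqP//|].
by rewrite gt_eqF// v0//; exact: simple_pos.
Qed.

(** If the image were negative, [b] and its opposite would be nonnegative combinations of simple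
    roots whose sum is a multiple of [a]. By [simple_free] only [a] could occur in [b], and
    reducedness would give [b = a]. *)
Lemma simple_reflection_pos {a b} :
  S a -> Dp b -> b != a -> Dp (reflection f a b).
Proof.
move=> Sa Db ba; have Da := pos_root (simple_pos Sa).
have [//|Dr] := posVneg (rs_reflection rsD Da (pos_root Db)).
have [m mE] := pos_simple_sum Db; have [p pE] := pos_simple_sum Dr.
pose t := 2 * f b a / f a a.
have mp c : S c -> (m c + p c)%:R - t * (c == a)%:R = 0.
  apply: (simple_free (fun c => (m c + p c)%:R - t * (c == a)%:R)).
  under eq_bigr => d _ do
    rewrite scalerBl natrD scalerDl !scaler_nat -scalerA scaler_nat.
  rewrite big_split/= big_split/= -mE -pE sumrN -scaler_sumr simple_sum1//.
  by rewrite /reflection -/t opprB addrCA subrr addr0 subrr.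
have bE : b = (m a)%:R *: a.
  rewrite {1}mE -{2}(simple_sum1 Sa) scaler_sumr !big_seq; apply: eq_bigr => c.
  rewrite in_fset_set ?inE; last exact: simple_finite.
  move=> /mp; have [->|ca] := eqVneq c a; first by rewrite scaler_nat.
  rewrite mulr0 subr0 => /eqP; rewrite pnatr_eq0 addn_eq0 => /andP[/eqP -> _].
  by rewrite !mulr0n scaler0.
have [|m1|m1] := rs_reduced rsD (c := (m a)%:R) Da.
- by rewrite -bE; exact: pos_root.
- by move: ba; rewrite bE m1 scale1r eqxx.
- by have := ler0n R (m a); rewrite m1 oppr_ge0 ler10.
Qed.

(* Peel off a simple root [a] of [N] and apply the induction hypothesis to the
   image of [N `\ a] under the reflection in [a]. *)
Lemma biconvex_inversions (N : set 'rV[R]_n) :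
  N `<=` Dp ->
  (forall a b, N a -> N b -> D (a + b) -> N (a + b)) ->
  (forall a b, Dp a -> Dp b -> N (a + b) -> N a \/ N b) ->
  exists2 w, weyl f D w & inversions Dp w = N.
Proof.
have [k Nk] := ubnP #|` fset_set N|.
elim: k N Nk => // k IH N Nk Npos Nadd Nco.
(* Splitting a root of [N] repeatedly leads to a simple root of [N]. Without simple roots [N] is
   therefore empty, the inversion set of the identity. *)
have [N0|/existsPNP[a Sa Na]] := pselect (forall a, S a -> ~ N a).
  exists id; first exact: weyl_id.
  apply/seteqP; split=> a; first by move=> [/pos_opp].
  move=> Na; exfalso; move: (Na); move: (Npos _ Na); move: a {Na}.
  by apply: pos_ind => // a b Da Db _ IHa IHb /(Nco _ _ Da Db)[].
rewrite notK in Na.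
have Dpa := simple_pos Sa; have Da := pos_root Dpa; have a0 := root_neq0 rsD Da.
pose s := reflection f a.
have sK : involutive s by exact: reflectionK.
have sa : s a = - a by exact: reflection_self.
have sD : {morph s : x y / x + y} by exact: reflectionD.
have sDp b : Dp b -> b != a -> Dp (s b) by exact: simple_reflection_pos.
have sroot b : D b -> D (s b) by exact: (rs_reflection rsD).
have Nfin : finite_set N by apply: sub_finite_set pos_finite.
have s_neq b : Dp b -> s b != a.
  move=> Db; apply/eqP => sb; apply: (pos_opp Db).
  by rewrite -(sK b) sb sa opprK.
have add_neq b c : Dp b -> Dp c -> b + c != a.
  by move=> Db Dc; apply/eqP => bc; case: Sa => _; apply; exists b, c.
have memE b : Dp b -> (s @` (N `\ a)) b <-> b != a /\ N (s b).
  move=> Db; split=> [[c [Nc ca] <-]|[ba Nb]].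
    by rewrite sK s_neq//; exact: Npos.
  by exists (s b); rewrite ?sK//; split=> //; apply/eqP; exact: s_neq.
(* This covers a summand equal to [a], whose image [- a] is not positive: [s c] is the sum of [a]
   and [s a + s c], both in [N]. *)
have co_a c : Dp c -> N (s a + s c) -> (s @` (N `\ a)) c.
  move=> Dc; rewrite sa => Nac.
  have ca : c != a.
    apply/eqP => ca; move: (Npos _ Nac); rewrite ca sa => /pos_add /(_ Dpa).
    rewrite subrK => /(_ (root_opp rsD Da)); exact: pos_opp.
  apply/memE => //; split=> //; rewrite -(addNKr a (s c)); apply: Nadd => //.
  by rewrite addNKr; apply: sroot; exact: pos_root.
have [] := IH (s @` (N `\ a)).
- rewrite fset_set_image; last exact: finite_setD.
  apply: (leq_ltn_trans (leq_imfset_card _ _ _)).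
  by move: Nk; rewrite fset_setD1// (cardfsD1 a) in_fset_set// mem_set.
- by move=> _ [b [Nb /eqP ba] <-]; apply: sDp => //; exact: Npos.
- move=> _ _ [b [Nb ba] <-] [c [Nc ca] <-]; rewrite -sD => /sroot.
  rewrite sK => Dbc; exists (b + c) => //; split; first exact: Nadd.
  by apply/eqP; apply: add_neq; exact: Npos.
- move=> b c Db Dc [d [Nd da]] sd.
  have {Nd} Nbc : N (s b + s c) by rewrite -sD -sd sK.
  have [ba|ba] := eqVneq b a; first by right; apply: co_a => //; rewrite -ba.
  have [ca|ca] := eqVneq c a.
    by left; apply: co_a => //; rewrite addrC -ca.
  by have [] := Nco _ _ (sDp _ Db ba) (sDp _ Dc ca) Nbc; [left|right]; apply/memE.
move=> w wW wN; exists (w \o s); first exact: weyl_compr.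
(* The image of [N] without [a] does not contain [a], so [w] keeps [a] positive and [w \o s] inverts
   it. *)
have wNa : Dp (w a).
  have [//|wa] := posVneg (weyl_root rsD wW Da).
  have : inversions Dp w a by split.
  by rewrite wN => /(memE _ Dpa)[]; rewrite eqxx.
apply/seteqP; split=> b.
  move=> [Db wb]; have [->//|ba] := eqVneq b a.
  have : inversions Dp w (s b) by split=> //; exact: sDp.
  by rewrite wN => /(memE _ (sDp _ Db ba))[]; rewrite sK.
move=> Nb; have Db := Npos _ Nb; split=> //=.
have [->|ba] := eqVneq b a; first by rewrite sa (weylN wW) opprK.
suff [] : inversions Dp w (s b) by [].
by rewrite wN; apply/memE; [exact: sDp|rewrite sK s_neq].
Qed.

End PositiveSystem.

(** * Small chambers, their inversion sets and their distances *)

Section Chambers.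
Context {R : realType} {n : nat} {f : {dot 'rV[R]_n for idfun}}.
Context {D Dp : set 'rV[R]_n}.
Context (rsD : root_system f D) (posDp : positive_system f D Dp).
Implicit Types (a b c x y : 'rV[R]_n) (w u : 'rV[R]_n -> 'rV[R]_n).
Local Notation S := (simple_roots Dp).
Local Notation C := (open_chamber f (simple_roots Dp)).

Lemma chamber_pos {x a} : C x -> Dp a -> 0 < f x a.
Proof.
move=> Cx; move: a; apply: (pos_ind rsD posDp) => [|a b _ _ _ fa fb]; first exact: Cx.
by rewrite dotDr addr_gt0.
Qed.

Lemma chamber_neq0 : C !=set0.
Proof.
by have [v v0] := pos_vector posDp; exists v => a /simple_pos; exact: v0.
Qed.

(** The Weyl group is closed under inverses, so preimages can replace images; membership in a
    preimage needs no witness. *)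
Lemma small_chambersP A :
  small_chambers f D Dp A <-> exists2 w, weyl f D w & A = w @^-1` C.
Proof.
have imE w w' : cancel w w' -> cancel w' w -> w @` C = w' @^-1` C.
  move=> wK w'K; apply/seteqP; split=> [_ [x Cx <-]|x Cx]; first by rewrite /= wK.
  by exists (w' x).
split=> [[w wW <-]|[w wW ->]]; have [w' [w'W wK w'K]] := weyl_inv rsD wW.
  by exists w' => //; exact: imE.
by exists w' => //; exact: imE.
Qed.

Lemma weyl_chamber_neq0 {w} : weyl f D w -> w @^-1` C !=set0.
Proof.
move=> /(weyl_inv rsD)[w' [_ _ w'K]]; have [v Cv] := chamber_neq0.
by exists (w' v); rewrite /= w'K.
Qed.

(** Since [f x a = f (w x) (w a)], the sign of [a] on the chamber tells whether the root [w a] is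
    positive. *)
Lemma weyl_chamberP {w} x : weyl f D w ->
  (w @^-1` C) x <-> forall a, Dp a -> if `[<inversions Dp w a>] then f x a < 0
                                      else 0 < f x a.
Proof.
move=> wW; split=> [Cx a Da|xP a Sa].
  have Dwa := weyl_root rsD wW (pos_root posDp Da).
  rewrite -(weyl_dot rsD wW); case: asboolP => [[_ wa]|Nwa].
    by rewrite -oppr_gt0 -dotNr chamber_pos.
  apply: chamber_pos => //; have [//|wa] := posVneg rsD posDp Dwa.
  by case: Nwa.
have [w' [w'W wK w'K]] := weyl_inv rsD wW.
have Da := simple_pos Sa; have Dw'a := weyl_root rsD w'W (pos_root posDp Da).
rewrite -[a]w'K (weyl_dot rsD wW).
(* The sign pattern is applied to whichever of [w' a] and [- w' a] is positive. *)
have [Dw'|Dw'] := posVneg rsD posDp Dw'a; have := xP _ Dw'; case: asboolP => //.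
- by case=> _; rewrite w'K => /(pos_opp posDp Da).
- by rewrite dotNr oppr_lt0.
- by case; split=> //; rewrite (weylN wW) w'K opprK.
Qed.

Lemma weyl_chamber_lt0 {w x a} : weyl f D w -> (w @^-1` C) x -> Dp a ->
  f x a < 0 <-> inversions Dp w a.
Proof.
move=> wW /(weyl_chamberP _ wW) xP /xP; case: asboolP => wa xa; split=> //.
by rewrite ltNge ltW.
Qed.

Lemma weyl_chamber_gt0 {w x a} : weyl f D w -> (w @^-1` C) x -> Dp a ->
  0 < f x a <-> ~ inversions Dp w a.
Proof.
move=> wW /(weyl_chamberP _ wW) xP /xP; case: asboolP => wa xa; split=> //.
by rewrite ltNge ltW.
Qed.

Lemma eq_weyl_chamber {w u} : weyl f D w -> weyl f D u ->
  inversions Dp w = inversions Dp u -> w @^-1` C = u @^-1` C.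
Proof.
move=> wW uW wu; apply/seteqP; split=> x.
  by move=> /(weyl_chamberP _ wW); rewrite wu => /(weyl_chamberP _ uW).
by move=> /(weyl_chamberP _ uW); rewrite -wu => /(weyl_chamberP _ wW).
Qed.

(** Distances count hyperplanes, inclusions compare roots; this links the two. The component of [b]
    orthogonal to [a] lies in both hyperplanes, so it is orthogonal to itself and vanishes;
    reducedness and positivity do the rest. *)
Lemma hyperplane_inj {a b} : Dp a -> Dp b ->
  hyperplane f a = hyperplane f b -> a = b.
Proof.
move=> Da Db ab; have aD := pos_root posDp Da; have bD := pos_root posDp Db.
have aa := dot_gt0 f (root_neq0 rsD aD); pose t := f b a / f a a.
have bE : b = t *: a.
  have ra : hyperplane f a (b - t *: a).
    by rewrite /hyperplane /= dotBl dotZl divfK ?subrr// gt_eqF.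
  have rb : hyperplane f b (b - t *: a) by rewrite -ab.
  apply/eqP; rewrite -subr_eq0; apply/eqP; apply: (dot_le0_eq0 f).
  by rewrite [in X in X <= _]dotBr dotZr ra rb mulr0 subr0.
have [|t1|t1] := rs_reduced rsD (c := t) aD; first by rewrite -bE.
  by rewrite bE t1 scale1r.
by case: (pos_opp posDp Da); rewrite -scaleN1r -t1 -bE.
Qed.

(** All positive roots are positive on [C], so a separating root is negative on the other chamber,
    which puts it in [N(w)]. *)
Lemma weyl_chamber_dist {w} : weyl f D w ->
  chamber_dist f Dp (w @^-1` C) C =
    #|` fset_set [set hyperplane f a | a in inversions Dp w]|.
Proof.
move=> wW; rewrite /chamber_dist; congr (#|` fset_set (_ @` _)|).
have [x wx] := weyl_chamber_neq0 wW; have [y Cy] := chamber_neq0.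
apply/seteqP; split=> a.
  move=> [Da [/(_ x y wx Cy)/andP[+ _]|/(_ x y wx Cy)/andP[]]].
    by move=> /(weyl_chamber_lt0 wW wx Da).
  by rewrite ltNge (ltW (chamber_pos Cy Da)).
move=> wa; have [Da _] := wa; split=> //; left=> {wx Cy}x {}y wx Cy.
by rewrite chamber_pos// andbT; apply/(weyl_chamber_lt0 wW wx Da).
Qed.

(** Nested finite sets of the same cardinality coincide; the second half gives the uniqueness of the
    closest and of the farthest chamber. *)
Lemma chamber_dist_le {w u} : weyl f D w -> weyl f D u ->
  inversions Dp w `<=` inversions Dp u ->
  (chamber_dist f Dp (w @^-1` C) C <= chamber_dist f Dp (u @^-1` C) C)%N /\
  ((chamber_dist f Dp (u @^-1` C) C <= chamber_dist f Dp (w @^-1` C) C)%N ->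
    w @^-1` C = u @^-1` C).
Proof.
move=> wW uW wu; rewrite !weyl_chamber_dist//.
have fin v : finite_set [set hyperplane f a | a in inversions Dp v].
  apply: finite_image; apply: sub_finite_set (pos_finite rsD posDp).
  by move=> a [].
have sub : [set hyperplane f a | a in inversions Dp w] `<=`
           [set hyperplane f a | a in inversions Dp u] by exact: image_subset.
have := sub; rewrite fset_set_sub// => sub'.
split; first exact: fsubset_leq_card.
move=> uw; apply: eq_weyl_chamber => //; apply/seteqP; split=> // a ua.
have : [set hyperplane f a | a in inversions Dp w] (hyperplane f a).
  have /fset_set_inj -> // : fset_set [set hyperplane f a | a in inversions Dp w] =
    fset_set [set hyperplane f a | a in inversions Dp u].
    by apply/eqP; rewrite -(fsubset_leqif_cards sub') eqn_leq uw fsubset_leq_card.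
  by exists a.
by move=> [b wb /hyperplane_inj <-] //; case: ua; case: wb.
Qed.

Lemma closest_chambersE {w} (U : set 'rV[R]_n) :
  weyl f D w -> w @^-1` C `<=` U ->
  (forall u, weyl f D u -> u @^-1` C `<=` U ->
     inversions Dp w `<=` inversions Dp u) ->
  closest_chambers f D Dp U = [set w @^-1` C].
Proof.
move=> wW wU wmin.
have wS : small_chambers f D Dp (w @^-1` C) by apply/small_chambersP; exists w.
apply/seteqP; split=> [A [[/small_chambersP[u uW ->] uU] umin]|_ ->].
  have [_ ->//] := chamber_dist_le wW uW (wmin _ uW uU); exact: umin.
split=> // B [/small_chambersP[u uW ->] uU].
by have [] := chamber_dist_le wW uW (wmin _ uW uU).
Qed.

Lemma farthest_chambersE {w} (U : set 'rV[R]_n) :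
  weyl f D w -> w @^-1` C `<=` U ->
  (forall u, weyl f D u -> u @^-1` C `<=` U ->
     inversions Dp u `<=` inversions Dp w) ->
  farthest_chambers f D Dp U = [set w @^-1` C].
Proof.
move=> wW wU wmax.
have wS : small_chambers f D Dp (w @^-1` C) by apply/small_chambersP; exists w.
apply/seteqP; split=> [A [[/small_chambersP[u uW ->] uU] umax]|_ ->].
  have [_ <-//] := chamber_dist_le uW wW (wmax _ uW uU); exact: umax.
split=> // B [/small_chambersP[u uW ->] uU].
by have [] := chamber_dist_le uW wW (wmax _ uW uU).
Qed.

End Chambers.

(** * The closure of a set of positive roots under addition *)

Section Generated.
Context {R : realType} {n : nat} {f : {dot 'rV[R]_n for idfun}}.
Context {D Dp : set 'rV[R]_n}.
Context (rsD : root_system f D) (posDp : positive_system f D Dp).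
Context {J : set 'rV[R]_n}.
Implicit Types a b c x y : 'rV[R]_n.

Lemma sub_generated : J `<=` generated D J.
Proof. by move=> a Ja; exists 0. Qed.

Lemma generated_ind (P : set 'rV[R]_n) : J `<=` P ->
  (forall a b, P a -> P b -> D (a + b) -> P (a + b)) -> generated D J `<=` P.
Proof.
move=> JP PD a [k _]; elim: k a => [|k IH] a /=; first exact: JP.
by move=> [[b Jb [c /IH Pc <-]] Da]; apply: PD => //; exact: JP.
Qed.

Lemma generated_pos : J `<=` Dp -> generated D J `<=` Dp.
Proof. by move=> JDp; apply: generated_ind => // a b; exact: (pos_add posDp). Qed.

(** [iter_sums] adds one element of [J] at a time, on the left. For [(p + q) + b], [root_exchange]
    makes [p + b] or [q + b] a root, and the sum is rebracketed as [q + (p + b)] or [p + (q + b)],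
    where induction on the length of [q] applies. Positivity excludes zero sums. *)
Lemma generated_add (JDp : J `<=` Dp) {a b} :
  generated D J a -> generated D J b -> D (a + b) -> generated D J (a + b).
Proof.
move=> [i _ ia]; elim: i a ia b => [|i IH] a /=.
  by move=> Ja b [j _ jb] Dab; exists j.+1 => //; split=> //; exists a => //; exists b.
move=> [[p Jp [q iq <-]] Dpq] b gb Dpqb.
have gq : generated D J q by exists i.
have Dp_p := JDp _ Jp; have Dp_q := generated_pos JDp _ gq.
have Dp_b := generated_pos JDp _ gb.
have cons c : generated D J c -> D (p + c) -> generated D J (p + c).
  by move=> [j _ jc] Dpc; exists j.+1 => //; split=> //; exists p => //; exists c.
have [Dpb|Dqb|pb|qb] := root_exchange rsD
  (pos_root posDp Dp_p) (pos_root posDp Dp_q) (pos_root posDp Dp_b) Dpq Dpqb.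
- have gpb := cons _ gb Dpb.
  by move: Dpqb; rewrite addrAC addrC => Dqpb; apply: IH.
- by move: Dpqb; rewrite -addrA; apply: cons; apply: IH.
- by have := pos_add_neq0 posDp Dp_p Dp_b; rewrite pb eqxx.
- by have := pos_add_neq0 posDp Dp_q Dp_b; rewrite qb eqxx.
Qed.

End Generated.

(** * Degrees of positive roots and lower ideals *)

Section Grading.
Context {R : realType} {n : nat} {f : {dot 'rV[R]_n for idfun}}.
Context {D Dp : set 'rV[R]_n} {G : int -> set 'rV[R]_n}.
Context (rsD : root_system f D) (grD : zgrading D G).
Context (compDp : compatible f D G Dp).
Implicit Types (a b c x y : 'rV[R]_n) (w u : 'rV[R]_n -> 'rV[R]_n).
Implicit Types I J : set 'rV[R]_n.
Local Notation S := (simple_roots Dp).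
Local Notation C := (open_chamber f (simple_roots Dp)).

Let posDp : positive_system f D Dp. Proof. by case: compDp. Qed.

Lemma degree_inj {i j a} : G i a -> G j a -> i = j.
Proof.
by case: grD => _ /(_ i j Logic.I Logic.I) GI _ ia ja; apply: GI; exists a.
Qed.

Lemma degree_add {i j a b} : G i a -> G j b -> D (a + b) -> G (i + j) (a + b).
Proof. by case: grD => _ _; apply. Qed.

Lemma pos_degree {a} : Dp a -> exists k : nat, G k a.
Proof.
case: compDp => _ _ -> _ [[_ a0]|[k /= k1 ak]]; first by exists 0.
by exists `|k|%N; rewrite gez0_abs// (le_trans _ k1).
Qed.

Lemma degree1_pos : G 1 `<=` Dp.
Proof. by case: compDp => _ _ -> _ a a1; right; exists 1. Qed.

Lemma degree_ge1_not0 {a} : Dp a -> degree_ge1 G a <-> ~ G 0 a.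
Proof.
move=> Da; split=> [[k /= + ka] a0|a0].
  by rewrite (degree_inj ka a0).
by case: compDp => _ _ E _; move: Da; rewrite E => -[[]|].
Qed.

Lemma degree0_split {a b} : Dp a -> Dp b -> G 0 (a + b) -> G 0 a /\ G 0 b.
Proof.
move=> /pos_degree[i ia] /pos_degree[j jb] ab0.
have Dab : D (a + b) by case: grD => -> _ _; exists 0.
have := degree_inj (degree_add ia jb Dab) ab0.
by move: ia jb; case: i => //; case: j.
Qed.

Lemma degree1_split {a b} : Dp a -> Dp b -> G 1 (a + b) ->
  G 0 a /\ G 1 b \/ G 1 a /\ G 0 b.
Proof.
move=> /pos_degree[i ia] /pos_degree[j jb] ab1.
have Dab : D (a + b) by case: grD => -> _ _; exists 1.
have := degree_inj (degree_add ia jb Dab) ab1.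
move: ia jb; case: i => [|[|i]] ia; case: j => [|[|j]] jb; try lia.
- by left.
- by right.
Qed.

(** Degrees are additive and nonnegative on positive roots, so a root of degree 1 uses exactly one
    simple root of nonzero degree, and a root of degree 0 uses none. *)
Lemma degree_simple_sum {a} : Dp a -> exists m : 'rV[R]_n -> nat,
  [/\ a = \sum_(b <- fset_set S) b *+ m b,
      G 0 a -> (\sum_(b <- fset_set S | b \notin G 0) m b = 0)%N &
      G 1 a -> (\sum_(b <- fset_set S | b \notin G 0) m b = 1)%N].
Proof.
move: a; apply: (pos_ind rsD posDp) => [a Sa|a b Da Db _ [m [mE m0 m1]] [p [pE p0 p1]]].
  have aS : a \in fset_set S.
    by rewrite in_fset_set ?inE//; exact: (simple_finite rsD posDp).
  exists (fun b => b == a); split; first by rewrite (simple_sum1 rsD posDp).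
    move=> a0; rewrite big1// => b; have [->|//] := eqVneq b a.
    by rewrite mem_set.
  move=> a1; rewrite big_mkcond (bigD1_seq a) ?fset_uniq//= eqxx big1.
    by rewrite ifT// notin_setE => a0; have := degree_inj a0 a1.
  by move=> b /negPf ->; case: ifP.
exists (fun c => m c + p c)%N; split.
- by rewrite {1}mE {1}pE -big_split/=; apply: eq_bigr => c _; rewrite mulrnDr.
- by move=> /(degree0_split Da Db)[/m0 + /p0]; rewrite big_split/= => -> ->.
- rewrite big_split/=.
  by move=> /(degree1_split Da Db)[[/m0 -> /p1 ->]|[/m1 -> /p0 ->]].
Qed.

(** A positive root of degree 0 splits only into positive roots of degree 0, hence down to
    [Pi(0)]. *)
Lemma chamber0_pos {x a} : chamber0 f G Dp x -> Dp a -> G 0 a -> 0 < f x a.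
Proof.
move=> x0; move: a; apply: (pos_ind rsD posDp) => [a Sa a0|a b Da Db _ fa fb].
  exact: x0.
by move=> /(degree0_split Da Db)[/fa + /fb]; rewrite dotDr; exact: addr_gt0.
Qed.

(* Both roots have degree 1, so only simple roots of degree 0 occur in their
   difference. *)
Lemma root_le_dot {x b c} : (forall a, S a -> G 0 a -> 0 <= f x a) ->
  G 1 b -> G 1 c -> root_le Dp b c -> f x b <= f x c.
Proof.
move=> x0 b1 c1 [k kE].
have [m [mE _ /(_ b1) m1]] := degree_simple_sum (degree1_pos _ b1).
have [p [pE _ /(_ c1) p1]] := degree_simple_sum (degree1_pos _ c1).
have mS a : a \in fset_set S -> S a.
  by rewrite in_fset_set ?inE//; exact: (simple_finite rsD posDp).
have mkp a : S a -> p a = (m a + k a)%N.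
  move=> Sa; apply/eqP; rewrite -(eqr_nat R) -subr_eq0; apply/eqP.
  apply: (simple_free rsD posDp (fun a => (p a)%:R - (m a + k a)%:R)) => //.
  under eq_bigr => d _ do rewrite scalerBl natrD scalerDl !scaler_nat.
  by rewrite big_split/= sumrN big_split/= -pE -mE -kE (addrC b) subrK subrr.
rewrite -subr_ge0 -dotBr kE dot_sumr big_seq; apply: sumr_ge0 => a aS.
have Sa := mS _ aS; rewrite linearMnr.
have [a0|Na0] := pselect (G 0 a); first by rewrite mulrn_wge0// x0.
have : (\sum_(d <- fset_set S | d \notin G 0) k d = 0)%N.
  have : (\sum_(d <- fset_set S | d \notin G 0) p d =
          \sum_(d <- fset_set S | d \notin G 0) m d +
          \sum_(d <- fset_set S | d \notin G 0) k d)%N.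
    rewrite -big_split/= big_seq_cond [RHS]big_seq_cond.
    by apply: eq_bigr => d /andP[/mS /mkp].
  by rewrite m1 p1 add1n => -[].
move=> /eqP; rewrite sum_nat_seq_eq0 => /allP /(_ _ aS) /implyP.
by rewrite notin_setE => /(_ Na0) /eqP ->.
Qed.

(** A sum of [k.+1] elements of [J] has degree [k.+1]. Thus [<J>] has no root of degree 1 outside
    [J], and a lower ideal can be recovered from the set it generates. *)
Lemma generated_degree {J a} : J `<=` G 1 -> generated D J a ->
  degree_ge1 G a /\ (G 1 a -> J a).
Proof.
move=> J1 [k _ ka].
have kG : forall i b, iter_sums D J i b -> G i.+1 b.
  elim=> [|i IH] b /=; first exact: J1.
  by move=> [[p /J1 p1 [q /IH qi <-]]]; exact: (degree_add p1 qi).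
split; first by exists k.+1; [|exact: kG].
move=> a1; have := degree_inj a1 (kG _ _ ka).
by case: k ka.
Qed.

(* If [a + b = p + q] with [p] in [I] and [q] a shorter sum, then by
   [root_exchange] [a - p] or [b - p] is a root or 0; say [a - p]. If it is
   positive, then induction applies to [q = (a - p) + b]; if it is negative,
   then [p = a + (p - a)] and [b = q + (p - a)]. *)
Lemma generated_coclosed {I a b} : lower_ideals G Dp I ->
  Dp a -> Dp b -> generated D I (a + b) -> generated D I a \/ generated D I b.
Proof.
move=> [I1 Ile].
have Ipos : I `<=` Dp by move=> c /I1; exact: degree1_pos.
have gadd := @generated_add _ _ _ _ _ rsD posDp _ Ipos.
(* One of the two summands has degree 1; it lies below the sum, hence in the lower ideal. *)
have co0 c d : Dp c -> Dp d -> I (c + d) -> I c \/ I d.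
  move=> Dc Dd Icd; have [[_ d1]|[c1 _]] := degree1_split Dc Dd (I1 _ Icd).
    right; apply: (Ile _ _ Icd) => //; rewrite addrC.
    exact: (root_le_addr rsD posDp).
  left; apply: (Ile _ _ Icd) => //; exact: (root_le_addr rsD posDp).
move=> + + [k _]; elim: k a b => [|k IH] a b Da Db /=.
  by move=> /(co0 _ _ Da Db)[/sub_generated|/sub_generated]; [left|right].
move=> [[p Ip [q kq pqab]] Dab].
have gp : generated D I p by exact: sub_generated.
have gq : generated D I q by exists k.
(* Stated for any pair with sum [a + b], so that it serves for both orders of [a] and [b]. *)
have half c d : Dp c -> Dp d -> c + d = a + b -> D (c - p) \/ c - p = 0 ->
    generated D I c \/ generated D I d.
  move=> Dc Dd cd; have cE : c = p + (c - p) by rewrite addrC subrK.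
  have qE : q = (c - p) + d by rewrite addrAC cd -pqab addrAC subrr add0r.
  move=> [Dcp|cp0]; last first.
    by left; rewrite cE cp0 addr0.
  have [cp|pc] := posVneg rsD posDp Dcp.
    rewrite qE in kq; have [gcp|] := IH _ _ cp Dd kq; last by right.
    left; rewrite cE; apply: gadd => //; rewrite -cE; exact: (pos_root posDp).
  rewrite opprB in pc.
  have Icp : I (c + (p - c)) by rewrite addrC subrK.
  have [/sub_generated|/sub_generated gpc] := co0 _ _ Dc pc Icp; first by left.
  have dE : d = q + (p - c).
    by rewrite qE addrAC -[p - c]opprB addrN add0r.
  by right; rewrite dE; apply: gadd => //; rewrite -dE; exact: (pos_root posDp).
have DNp : D (- p) by apply: (root_opp rsD); exact: (pos_root posDp (Ipos _ Ip)).
have Dabp : D (a + b - p).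
  rewrite -pqab addrAC subrr add0r.
  by apply: (pos_root posDp); apply: (generated_pos posDp) gq.
have [Dap|Dbp|ap|bp] := root_exchange rsD
  (pos_root posDp Da) (pos_root posDp Db) DNp Dab Dabp.
- by apply: half => //; left.
- by apply/or_comm; apply: half => //; [exact: addrC|left].
- by apply: half => //; right.
- by apply/or_comm; apply: half => //; [exact: addrC|right].
Qed.

Lemma lower_ideal_inversions {I} : lower_ideals G Dp I ->
  exists2 w, weyl f D w & inversions Dp w = generated D I.
Proof.
move=> Ilow; have [I1 _] := Ilow.
have Ipos : I `<=` Dp by move=> c /I1; exact: degree1_pos.
apply: (biconvex_inversions rsD posDp).
- exact: (generated_pos posDp).
- by move=> a b; exact: (generated_add rsD posDp Ipos).
- by move=> a b; exact: generated_coclosed.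
Qed.

(** * Small chambers inside a region and the two extreme ones *)

Lemma weyl_chamber_sub_region {w} : weyl f D w ->
  inversions Dp w `<=` degree_ge1 G ->
  w @^-1` C `<=` region f G Dp (inversions1 G Dp w).
Proof.
move=> wW w1 x wx; split=> [a [Sa a0]|].
  have Da := simple_pos Sa; apply/(weyl_chamber_gt0 rsD posDp wW wx Da).
  by move=> /w1 /(degree_ge1_not0 Da).
split=> a [wa a1].
  by apply/(weyl_chamber_lt0 rsD posDp wW wx) => //; case: wa.
apply/(weyl_chamber_gt0 rsD posDp wW wx); first exact: degree1_pos.
by move=> wa'; apply: a1.
Qed.

Lemma region_neq0 {I} : lower_ideals G Dp I -> region f G Dp I !=set0.
Proof.
move=> Ilow; have [I1 _] := Ilow; have [w wW wE] := lower_ideal_inversions Ilow.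
have -> : I = inversions1 G Dp w.
  rewrite /inversions1 wE; apply/seteqP; split=> a.
    by move=> Ia; split; [exact: sub_generated|exact: I1].
  by move=> [/(generated_degree I1)[_ Ia] /Ia].
have [x wx] := weyl_chamber_neq0 rsD posDp wW.
exists x; apply: weyl_chamber_sub_region wx => //.
by rewrite wE => a /(generated_degree I1)[].
Qed.

Lemma W0_min_closest {w} : W0_min f D G Dp w ->
  closest_chambers f D Dp (region f G Dp (inversions1 G Dp w)) = [set w @^-1` C].
Proof.
move=> [wW [I [I1 _] wE]]; apply: (closest_chambersE rsD posDp) => //.
  by apply: weyl_chamber_sub_region => //; rewrite wE => a /(generated_degree I1)[].
move=> u uW uR a wa; have [Da _] := wa.
(* One point decides membership in [N(u)], since signs of roots are constant on a small chamber. *)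
have [x ux] := weyl_chamber_neq0 rsD posDp uW; have [_ [xI _]] := uR _ ux.
apply/(weyl_chamber_lt0 rsD posDp uW ux Da).
have : generated D I a by rewrite -wE.
apply: (@generated_ind _ _ _ _ [set a | f x a < 0]) => [b Ib|b c fb fc _] /=.
  by apply: xI; split; [rewrite wE; exact: sub_generated|exact: I1].
by rewrite dotDr -oppr_gt0 opprD addr_gt0// oppr_gt0.
Qed.

Lemma W0_max_farthest {w} : W0_max f D G Dp w ->
  farthest_chambers f D Dp (region f G Dp (inversions1 G Dp w)) = [set w @^-1` C].
Proof.
move=> [wW [I [I1 _] wE]]; apply: (farthest_chambersE rsD posDp) => //.
  by apply: weyl_chamber_sub_region => //; rewrite wE => a [].
move=> u uW uR a ua; have [Da _] := ua.
have [x ux] := weyl_chamber_neq0 rsD posDp uW; have [x0 [_ xI]] := uR _ ux.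
have xa : f x a < 0 by apply/(weyl_chamber_lt0 rsD posDp uW ux Da).
rewrite wE; split.
  (* Positive roots of degree 0 are positive on [C(0)], whereas [a] is negative at [x]. *)
  by apply/(degree_ge1_not0 Da) => /(chamber0_pos x0 Da); rewrite ltNge ltW.
move=> ga; suff : 0 < f x a by rewrite ltNge ltW.
move: ga; apply: (@generated_ind _ _ _ _ [set a | 0 < f x a]) =>
  [b [b1 bI]|b c fb fc _] /=.
  (* The region is indexed by [I_w], not by [I]; a root of [I^c] is outside [I_w] because [N(w)]
     avoids [<I^c>]. *)
  apply: xI; split=> // -[]; rewrite wE => -[_ Ng] _.
  by apply: Ng; apply: sub_generated.
by rewrite dotDr addr_gt0.
Qed.

End Grading.

(** * Regions as connected components, and the covering by closures *)

Section Regions.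
Context {R : realType} {n : nat} {f : {dot 'rV[R]_n for idfun}}.
Context {D Dp : set 'rV[R]_n} {G : int -> set 'rV[R]_n}.
Context (rsD : root_system f D) (grD : zgrading D G).
Context (compDp : compatible f D G Dp).
Implicit Types (a b c x y z : 'rV[R]_n).
Local Notation S := (simple_roots Dp).

Let posDp : positive_system f D Dp. Proof. by case: compDp. Qed.

(** The inner product is arbitrary, so continuity is read off the expansion of [x] in
    coordinates. *)
Lemma dot_continuous a : continuous (fun x => f x a).
Proof.
have -> : (fun x => f x a) = fun x => \sum_(i < n) x 0 i * f ('e_i) a.
  apply/funext => x; rewrite {1}(row_sum_delta x) dot_suml.
  by apply: eq_bigr => i _; rewrite dotZl.
apply: (continuous_big (x0 := 0) (op := +%R)) => [|i _ x]; first exact: add_continuous.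
by apply: cvgMr_tmp; [exact: nbhs_filter|exact: coord_continuous].
Qed.

Lemma line_continuous x y : continuous (fun t : R => x + t *: y).
Proof. by move=> t; apply: cvgD; [exact: cvg_cst|apply: cvgZr_tmp; exact: cvg_id]. Qed.

Lemma segment_in_region I x y (t : R) : region f G Dp I x -> region f G Dp I y ->
  0 <= t <= 1 -> region f G Dp I (x + t *: (y - x)).
Proof.
move=> [x0 [xI xI']] [y0 [yI yI']] /andP[t0 t1].
have E a : f (x + t *: (y - x)) a = (1 - t) * f x a + t * f y a.
  by rewrite dotDl dotZl dotBl; ring.
have gt0 (p q : R) : 0 < p -> 0 < q -> 0 < (1 - t) * p + t * q.
  move=> p0 q0; have [->|tN0] := eqVneq t 0; first by rewrite subr0 mul1r mul0r addr0.
  apply: ltr_wpDl; first by rewrite mulr_ge0 ?subr_ge0// ltW.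
  by rewrite mulr_gt0// lt_def tN0.
split; first by move=> a a0; rewrite E gt0//; [exact: x0|exact: y0].
split=> a aI; rewrite E; last by rewrite gt0//; [exact: xI'|exact: yI'].
rewrite -oppr_gt0 opprD -!mulrN gt0// oppr_gt0; [exact: xI|exact: yI].
Qed.

(** The image of [B] under a continuous real function is an interval; a change of sign would put 0
    in it. *)
Lemma connected_sign {B : set 'rV[R]_n} {x y a} : connected B -> B x -> B y ->
  (forall z, B z -> f z a != 0) -> f x a < 0 -> f y a < 0.
Proof.
move=> Bc Bx By B0 xa; rewrite ltNge; apply/negP => ya.
have : connected [set f z a | z in B].
  apply: connected_continuous_connected => //; apply: continuous_subspaceT.
  exact: dot_continuous.
move=> /connected_intervalP /(_ (f x a) (f y a)).
case/(_ _ _ 0); [by exists x|by exists y|by rewrite ltW|].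
by move=> z /B0/eqP.
Qed.

(** On the dissected chamber this is the index of the region containing [x], which provides the
    inverse of the map from lower ideals to regions. *)
Definition negative_part x : set 'rV[R]_n := [set a | G 1 a /\ f x a < 0].

(** The weak inequality admits limit points of the chamber of [Pi(0)], as the covering by closures
    requires. *)
Lemma negative_part_lower x : (forall a, S a -> G 0 a -> 0 <= f x a) ->
  lower_ideals G Dp (negative_part x).
Proof.
move=> x0; split=> [a []//|b c [c1 xc] b1 bc]; split=> //.
exact: (le_lt_trans (root_le_dot rsD grD compDp x0 b1 c1 bc)).
Qed.

Lemma region_negative_part {I x} : lower_ideals G Dp I ->
  region f G Dp I x -> negative_part x = I.
Proof.
move=> [I1 _] [_ [xI xI']]; apply/seteqP; split=> a.
  move=> [a1 xa]; apply: contrapT => aI.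
  by have := xI' _ (conj a1 aI); rewrite ltNge ltW.
by move=> Ia; split; [exact: I1|exact: xI].
Qed.

Lemma region_dissected {I x} : lower_ideals G Dp I ->
  region f G Dp I x -> dissected_chamber0 f G Dp x.
Proof.
move=> [I1 _] [x0 [xI xI']]; split=> // -[a a1] /=; rewrite /hyperplane /= => xa.
have [/xI|aI] := pselect (I a); first by rewrite xa ltxx.
by have := xI' _ (conj a1 aI); rewrite xa ltxx.
Qed.

Lemma dissected_region {x} : dissected_chamber0 f G Dp x ->
  region f G Dp (negative_part x) x.
Proof.
move=> [x0 xH]; split=> //; split=> [a []//|a [a1 aN]].
rewrite lt_def; apply/andP; split.
  by apply/eqP => xa; apply: xH; exists a.
by rewrite leNgt; apply/negP => xa; apply: aN.
Qed.

Lemma dissected_lower {x} : dissected_chamber0 f G Dp x ->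
  lower_ideals G Dp (negative_part x).
Proof.
by move=> [x0 _]; apply: negative_part_lower => a Sa a0; apply: ltW; exact: x0.
Qed.

(** Roots of degree 1 keep their signs on a connected subset of the dissected chamber, so the
    component stays in the region. Conversely, a segment joins [x] to any point of the convex
    region. *)
Lemma component_region {I x} : lower_ideals G Dp I -> region f G Dp I x ->
  connected_component (dissected_chamber0 f G Dp) x = region f G Dp I.
Proof.
move=> Ilow xI; apply/seteqP; split=> y.
  move=> [B [Bx BA Bc] By].
  rewrite -(region_negative_part Ilow xI).
  suff -> : negative_part x = negative_part y by apply: dissected_region; exact: BA.
  have B0 z a : G 1 a -> B z -> f z a != 0.
    by move=> a1 /BA[_ zH]; apply/eqP => za; apply: zH; exists a.
  by apply/seteqP; split=> a [a1 fa]; split=> //;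
    apply: (connected_sign Bc _ _ (fun z => B0 z a a1) fa).
move=> yI; exists [set x + t *: (y - x) | t in `[0, 1]%classic].
  split.
  - by exists 0; rewrite ?scale0r ?addr0//= in_itv/= lexx ler01.
  - move=> _ [t + <-]; rewrite /= in_itv/= => t01.
    by apply: (region_dissected Ilow); exact: segment_in_region.
  - apply: connected_continuous_connected; first exact: segment_connected.
    by apply: continuous_subspaceT; exact: line_continuous.
by exists 1; rewrite ?scale1r ?subrKC//= in_itv/= lexx ler01.
Qed.

(** Any point of a region determines the index through [negative_part]; as regions are nonempty,
    this gives injectivity. *)
Lemma region_bij :
  set_bij (lower_ideals G Dp) (dissection f G Dp) (region f G Dp).
Proof.
split.
- move=> I Ilow; have [x xI] := region_neq0 rsD grD compDp Ilow.
  exists x; first exact: region_dissected xI.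
  exact: component_region.
- move=> I J; rewrite !inE => Ilow Jlow IJ.
  have [x xI] := region_neq0 rsD grD compDp Ilow.
  by rewrite -(region_negative_part Ilow xI); apply: region_negative_part; rewrite -?IJ.
- move=> _ [x xA <-]; exists (negative_part x); first exact: dissected_lower.
  by apply/esym/component_region; [exact: dissected_lower|exact: dissected_region].
Qed.

(* A limit point [y] of the chamber of [Pi(0)] is pushed into a region by a
   small multiple of a vector that is positive on all positive roots. *)
Lemma closure_chamber0 : closure (chamber0 f G Dp) `<=`
  \bigcup_(I in lower_ideals G Dp) closure (region f G Dp I).
Proof.
move=> y yC.
have y0 a : S a -> G 0 a -> 0 <= f y a.
  move=> Sa a0.
  have Fc : closed [set x | 0 <= f x a].
    apply: (@preimage_closed _ _ (fun x => f x a) [set r | 0 <= r]).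
      by move=> x _; exact: dot_continuous.
    exact: closed_ge.
  have : closure [set x | 0 <= f x a] y.
    by apply: closureS yC => x x0; apply: ltW; apply: x0.
  by rewrite -(closure_id _).1.
have [v v0] := pos_vector posDp.
exists (negative_part y); first exact: negative_part_lower.
move=> B By.
have Nfin : finite_set (negative_part y).
  apply: sub_finite_set (pos_finite rsD posDp) => a [a1 _].
  exact: (degree1_pos compDp).
(* Finitely many roots are negative at [y], and they stay so near [y]. The other roots of degree 1
   are nonnegative at [y] and become positive after the push along [v]. *)
pose U := B `&` \bigcap_(a in [set` fset_set (negative_part y)]) [set z | f z a < 0].
have Uy : nbhs y U.
  apply: filterI => //; apply: filter_bigI => a; rewrite in_fset_set// inE => -[_ ya].
  have ya0 : nbhs (f y a) [set r | r < 0].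
    by apply: open_nbhs_nbhs; split=> //; exact: open_lt.
  exact: dot_continuous ya0.
have yv : (fun t : R => y + t *: v) t @[t --> 0] --> y.
  by have := line_continuous y v 0; rewrite /continuous_at scale0r addr0.
have /nbhs_ballP[e /= e0 eU] := yv _ Uy.
(* Any parameter strictly between 0 and [e] would do: positive for the push, small enough to stay in
   [U]. *)
have e20 : 0 < e / 2 by rewrite divr_gt0.
have e2e : ball (0 : R) e (e / 2).
  rewrite /ball /= sub0r normrN gtr0_norm// ltr_pdivrMr//.
  by rewrite ltr_pMr// ltr1n.
have [Byv Uyv] : U (y + (e / 2) *: v) := eU _ e2e.
have yvE a : f (y + (e / 2) *: v) a = f y a + e / 2 * f v a by rewrite dotDl dotZl.
exists (y + (e / 2) *: v); split=> //; split.
  move=> a [Sa a0]; rewrite yvE ltr_wpDl ?y0// mulr_gt0// v0//; exact: simple_pos.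
split=> a.
  by move=> Na; apply: Uyv; rewrite /= in_fset_set// inE.
move=> [a1 Na]; rewrite yvE ltr_wpDl// ?mulr_gt0 ?v0//;
  last exact: (degree1_pos compDp).
by rewrite leNgt; apply/negP => ya; apply: Na.
Qed.

End Regions.

Theorem theorem5p1 (R : realType) (n : nat) (f : {dot 'rV[R]_n for idfun})
    (D : set 'rV[R]_n) (G : int -> set 'rV[R]_n) (Dp : set 'rV[R]_n)
    (D_root_system : root_system f D) (D_irreducible : irreducible f D)
    (G_grading : zgrading D G) (Dp_compatible : compatible f D G Dp) :
  [/\ [/\ forall I, lower_ideals G Dp I -> region f G Dp I !=set0,
          set_bij (lower_ideals G Dp) (dissection f G Dp) (region f G Dp) &
          closure (chamber0 f G Dp) `<=`
            \bigcup_(I in lower_ideals G Dp) closure (region f G Dp I)],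
      forall w, W0_min f D G Dp w ->
        closest_chambers f D Dp (region f G Dp (inversions1 G Dp w)) =
          [set w @^-1` open_chamber f (simple_roots Dp)] &
      forall w, W0_max f D G Dp w ->
        farthest_chambers f D Dp (region f G Dp (inversions1 G Dp w)) =
          [set w @^-1` open_chamber f (simple_roots Dp)]].
Proof.
split; first split.
- move=> I; exact: (region_neq0 D_root_system G_grading Dp_compatible).
- exact: (region_bij D_root_system G_grading Dp_compatible).
- exact: (closure_chamber0 D_root_system G_grading Dp_compatible).
- move=> w; exact: (W0_min_closest D_root_system G_grading Dp_compatible).
- move=> w; exact: (W0_max_farthest D_root_system G_grading Dp_compatible).
Qed.
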